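(* Let $G=(V,E)$ be a finite simple graph with $|V|=n$. Then $G$ is special $2$-threshold if and only if there exist an ordering $v_1,\dots,v_n$ of $V$ and a subset $U\subseteq V$ such that for every $i\in\{1,\dots,n\}$, $$N^<(v_i)=\emptyset\quad\text{or}\quad N^<(v_i)=U\cap\{v_1,\dots,v_{i-1}\}.$$
   Context: Graphs are finite, without loops or parallel edges. For $v\in V$, $N(v)$ is the set of vertices adjacent to $v$; for $W\subseteq V$, $N_W(v)=N(v)\cap W$, and $G[W]$ is the induced subgraph on $W$. Given an ordering $v_1,\dots,v_n$ of $V$, the lower neighborhood of $v_i$ is $N^<(v_i)=N(v_i)\cap\{v_1,\dots,v_{i-1}\}$. For $U\subseteq V$, $G$ is called $U$-threshold if for every nonempty $W\subseteq V$ the induced subgraph $G[W]$ contains a vertex $v$ with $N_W(v)=\emptyset$ or $N_W(v)=(W\setminus\{v\})\cap U$. $G$ is special $2$-threshold if it is $U$-threshold for some $U\subseteq V$. *)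

(* Defs.v *)
From mathcomp Require Import all_boot.

Set Implicit Arguments.
Unset Strict Implicit.
Unset Printing Implicit Defensive.

Section Graph.

Variables (V : finType) (e : rel V).

(* Loopless undirected graphs without parallel edges, given by their
   adjacency relation. *)
Definition simple_graph : Prop := symmetric e /\ irreflexive e.

Definition nbhd (v : V) : {set V} := [set w | e v w].

Definition nbhd_in (W : {set V}) (v : V) : {set V} := nbhd v :&: W.

Definition threshold_wrt (U : {set V}) : Prop :=
  forall W : {set V}, W != set0 ->
    exists2 v, v \in W & nbhd_in W v = set0 \/ nbhd_in W v = (W :\ v) :&: U.

Definition special_2_threshold : Prop := exists U : {set V}, threshold_wrt U.

(* An ordering of the vertices is a bijection from 'I_n to V, indexed from 0. *)
Definition predecessors n (v : 'I_n -> V) (i : 'I_n) : {set V} :=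
  [set v j | j : 'I_n & j < i].

Definition lower_nbhd n (v : 'I_n -> V) (i : 'I_n) : {set V} :=
  nbhd (v i) :&: predecessors v i.

End Graph.

(* Main.v *)
Require Import Defs.
From mathcomp Require Import all_boot.

(* Removing one after the other the vertices provided by the threshold property
   lists V from last to first; conversely, the last vertex of W in the ordering
   is the vertex required in G[W]. The same set U serves in both directions. *)

(** Induction on [#|W|], with [W] arbitrary because the recursion passes to [W :\ v]. The default
    [x0] is quantified inside since [V] may be empty. *)
Lemma threshold_enumeration (V : finType) (e : rel V) (U W : {set V}) :
  threshold_wrt e U ->
  exists s : seq V, [/\ uniq s, s =i W &
    forall x0 i, i < size s ->
      let P := [set x in take i s] in
      nbhd e (nth x0 s i) :&: P = set0 \/ nbhd e (nth x0 s i) :&: P = U :&: P].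
Proof.
move=> thrU; have [k] := ubnP #|W|; elim: k W => // k IHk W ltWk.
have [->|W0] := eqVneq W set0.
  by exists [::]; split=> // x; rewrite inE.
have [v vW Nv] := thrU W W0.
have [|s [uniq_s sW ordered_s]] := IHk (W :\ v).
  by move: ltWk; rewrite (cardsD1 v W) vW.
exists (rcons s v); split=> [|x|x0 i].
- by rewrite rcons_uniq uniq_s sW !inE eqxx.
- by rewrite mem_rcons inE sW !inE; case: eqVneq => [->|].
(* Before the last index, appending [v] changes neither the entry nor its prefix; at index [size s]
   the entry is [v] and the prefix is all of [s]. *)
rewrite size_rcons ltnS leq_eqVlt => /predU1P[->|lt_is] /=; last first.
  by rewrite nth_rcons lt_is -cats1 takel_cat 1?ltnW //; apply: ordered_s.
rewrite nth_rcons ltnn eqxx -cats1 take_size_cat //.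
have -> : [set x in s] = W :\ v by apply/setP=> x; rewrite inE sW.
case: Nv => [N0|NU]; [left|right].
  by apply/eqP; rewrite -subset0 -N0 setIS // subD1set.
(* The set is [nbhd_in e W v] minus [v], and [(W :\ v) :&: U] already omits [v]. *)
rewrite setIDA -/(nbhd_in e W v) NU.
by apply/setP=> x; rewrite !inE; case: (x == v); rewrite //= andbC.
Qed.

(** Transfers the enumeration, phrased with list prefixes, to orderings indexed by ['I_n]. *)
Lemma mem_predecessors_tnth (V : finType) n (t : n.-tuple V) (i : 'I_n) :
  predecessors (tnth t) i = [set x in take i t].
Proof.
have x0 := tnth t i.
have size_i : size (take i t) = i by rewrite size_takel // size_tuple ltnW.
apply/setP=> x; rewrite inE; apply/imsetP/idP.
  move=> [j]; rewrite inE => lt_ji ->.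
  by rewrite (tnth_nth x0) -(nth_take x0 lt_ji) mem_nth // size_i.
move=> /(nthP x0)[j]; rewrite size_i => lt_ji <-.
exists (Ordinal (ltn_trans lt_ji (ltn_ord i))); first by rewrite inE.
by rewrite (tnth_nth x0) nth_take.
Qed.

Lemma ordering_threshold (V : finType) (e : rel V) n (v : 'I_n -> V)
    (U : {set V}) :
  irreflexive e -> bijective v ->
  (forall i, lower_nbhd e v i = set0 \/
             lower_nbhd e v i = U :&: predecessors v i) ->
  threshold_wrt e U.
Proof.
move=> irr_e [r vK rK] ordered_v W /set0Pn[w wW].
have w_in : v (r w) \in W by rewrite rK.
(* [v i] is the last vertex of [W]; by maximality all other vertices of [W] precede it. *)
have [i iW max_i] := @arg_maxnP _ (r w) (fun j => v j \in W) val w_in.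
have predW x : x \in W -> (x \in predecessors v i) = (x != v i).
  move=> xW; apply/imsetP/idP => [[j]|neq_x].
    rewrite inE => lt_ji ->; apply: contraTneq lt_ji => /(can_inj vK) ->.
    by rewrite ltnn.
  have le_rx : r x <= i by apply: max_i; rewrite rK.
  exists (r x); rewrite ?rK // inE ltn_neqAle le_rx andbT.
  by apply: contra neq_x => /eqP/val_inj <-; rewrite rK.
(* The only vertex of [W] that is not a predecessor is [v i] itself, which is no neighbour of itself
   as there are no loops. *)
have nbhdW x : x \in W ->
    (x \in nbhd e (v i)) = (x \in lower_nbhd e v i).
  move=> xW; rewrite !in_setI predW // inE andb_idr // => e_vx.
  by apply: contraTneq e_vx => ->; rewrite irr_e.
exists (v i) => //; case: (ordered_v i) => Ni; [left|right];
  apply/setP=> x; rewrite !in_setI; have [xW|] := boolP (x \in W);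
  rewrite ?andbF ?inE //= ?andbT.
- by move: (nbhdW x xW); rewrite Ni !inE.
- by move: (nbhdW x xW); rewrite Ni in_setI predW // inE andbC xW andbT.
- by move=> /negPf->; rewrite andbF.
Qed.

Theorem theorem3p2 (V : finType) (e : rel V) (n : nat)
    (Ge : simple_graph e) (cardV : #|V| = n) :
  special_2_threshold e <->
  exists (v : 'I_n -> V) (U : {set V}),
    bijective v /\
    forall i : 'I_n,
      lower_nbhd e v i = set0 \/ lower_nbhd e v i = U :&: predecessors v i.
Proof.
split=> [[U thrU]|[v [U [bij_v ordered_v]]]]; last first.
  by exists U; apply: ordering_threshold ordered_v => //; case: Ge.
have [s [uniq_s sT ordered_s]] := @threshold_enumeration V e U setT thrU.
have size_s : size s == n.
  by rewrite -(card_uniqP uniq_s) (eq_card sT) cardsT cardV.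
pose t := Tuple size_s; exists (tnth t), U; split.
  (* Injectivity, from [uniq s], suffices because ['I_n] and [V] have equal cardinality. *)
  apply: inj_card_bij; last by rewrite cardV card_ord.
  exact/tuple_uniqP.
move=> i; rewrite /lower_nbhd mem_predecessors_tnth (tnth_nth (tnth t i)).
by apply: ordered_s; rewrite (eqP size_s).
Qed.
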